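(* The set of homeomorphism classes of topological spaces of the form $\mathbb{N}_{a_n}$, where $\sum_{n=1}^\infty a_n$ ranges over all series of strictly positive real numbers, has cardinality exactly $|\mathbb{R}|$.
   Context: $\mathbb{N}=\{1,2,3,\dots\}$. For a series $\sum_{n=1}^\infty a_n$ of strictly positive real numbers and $A\subseteq\mathbb{N}$, write $\sum_A a_n=\sum_{n\in A}a_n\in[0,\infty]$. $\mathbb{N}_{a_n}$ denotes the set $\mathbb{N}$ with the topology whose closed sets are exactly $\mathbb{N}$ itself and all $A\subseteq\mathbb{N}$ with $\sum_A a_n<\infty$. *)

(* Defs.v *)
From HB Require Import structures.
From mathcomp Require Import all_boot all_order all_algebra.
From mathcomp Require Import all_classical all_reals all_analysis.

Set Implicit Arguments.
Unset Strict Implicit.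
Unset Printing Implicit Defensive.

Import Order.TTheory GRing.Theory Num.Theory.
Import numFieldNormedType.Exports.

Local Open Scope classical_set_scope.
Local Open Scope ring_scope.

(* Indices start at 0: the term [a n] stands for $a_{n+1}$, and the carrier
   [nat] for $\{1,2,3,\dots\}$. *)
Definition series_space (R : realType) (a : nat -> {posnum R}) : Type := nat.

Section series_space.
Context {R : realType} (a : nat -> {posnum R}).

HB.instance Definition _ := Choice.on (series_space a).

Definition series_closed (A : set (series_space a)) : Prop :=
  A = setT \/ (\esum_(n in A) ((a n)%:num)%:E < +oo)%E.

Let le_esum_sub (A B : set nat) : A `<=` B ->
  (\esum_(n in A) ((a n)%:num)%:E <= \esum_(n in B) ((a n)%:num)%:E)%E.
Proof.
move=> AB; rewrite (@esumID _ _ A B); last by move=> n _; rewrite lee_fin.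
rewrite (_ : B `&` A = A); last by apply/seteqP; split => [n []//|n An]; split => //; exact: AB.
by rewrite leeDl// esum_ge0// => n _; rewrite lee_fin.
Qed.

Let le_esumU (A B : set nat) :
  (\esum_(n in A `|` B) ((a n)%:num)%:E <=
   \esum_(n in A) ((a n)%:num)%:E + \esum_(n in B) ((a n)%:num)%:E)%E.
Proof.
rewrite (@esumID _ _ A (A `|` B)); last by move=> n _; rewrite lee_fin.
by apply: leeD; apply: le_esum_sub => n [] // [].
Qed.

Let series_open (U : set (series_space a)) : Prop := series_closed (~` U).

Let series_openT : series_open setT.
Proof. by right; rewrite setCT esum_set0. Qed.

Let series_openI : setI_closed series_open.
Proof.
move=> U V; rewrite /series_open setCI => -[->|Ufin]; first by left; rewrite setTU.
move=> [->|Vfin]; first by left; rewrite setUT.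
by right; apply: (le_lt_trans (le_esumU _ _)); rewrite lte_add_pinfty.
Qed.

Let series_open_bigU (I : Type) (f : I -> set (series_space a)) :
  (forall i, series_open (f i)) -> series_open (\bigcup_i f i).
Proof.
move=> fo; rewrite /series_open setC_bigcup.
have [fT|/existsNP[i fi]] := pselect (forall i, ~` f i = setT).
  by left; apply/seteqP; split => // n _ i _; rewrite fT.
right; have [//|ffin] := fo i.
by apply: le_lt_trans ffin; apply: le_esum_sub => n; apply.
Qed.

HB.instance Definition _ := isOpenTopological.Build (series_space a)
  series_openT series_openI series_open_bigU.

Lemma series_space_closedE (A : set (series_space a)) :
  closed A <-> series_closed A.
Proof. by rewrite -openC /open /= /series_open setCK. Qed.

End series_space.

Definition homeomorphic (X Y : topologicalType) : Prop :=
  exists (f : X -> Y) (g : Y -> X),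
    [/\ cancel f g, cancel g f, continuous f & continuous g].

(* A space on the carrier [nat] is recorded by its family of open sets. *)
Definition series_topology (R : realType) (a : nat -> {posnum R}) :
  set_system nat := [set U | open (U : set (series_space a))].

(* The class of the space given by [a], as the set of all spaces given by some
   series that are homeomorphic to it; the collection of all topological spaces
   homeomorphic to it does not fit in the universe of [set]. *)
Definition homeo_class (R : realType) (a : nat -> {posnum R}) :
  set (set_system nat) :=
  [set @series_topology R b | b in
    [set b | homeomorphic (series_space a) (series_space b)]].

Lemma homeomorphic_sym (X Y : topologicalType) :
  homeomorphic X Y -> homeomorphic Y X.
Proof. by move=> [f [g [? ? ? ?]]]; exists g, f. Qed.

Lemma homeomorphic_trans (X Y Z : topologicalType) :
  homeomorphic X Y -> homeomorphic Y Z -> homeomorphic X Z.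
Proof.
move=> [f [g [fg gf cf cg]]] [h [k [hk kh ch ck]]]; exists (h \o f), (g \o k).
split; [exact: can_comp|exact: can_comp| |] => x.
- exact: (continuous_comp (cf x) (ch _)).
- exact: (continuous_comp (ck x) (cg _)).
Qed.

Lemma series_topology_homeomorphic (R : realType) (a b : nat -> {posnum R}) :
  series_topology a = series_topology b ->
  homeomorphic (series_space a) (series_space b).
Proof.
move=> ab; exists (id : nat -> nat), (id : nat -> nat).
split => //; apply/continuousP => U oU.
- by have : series_topology a U by rewrite ab.
- by have : series_topology b U by rewrite -ab.
Qed.

Lemma homeo_classP (R : realType) (a b : nat -> {posnum R}) :
  homeo_class a = homeo_class b <->
  homeomorphic (series_space a) (series_space b).
Proof.
split => [ab|hab].
- have : homeo_class a (series_topology a).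
    by exists a => //; exact: series_topology_homeomorphic.
  rewrite ab => -[c /= bc /series_topology_homeomorphic ca].
  exact/homeomorphic_sym/(homeomorphic_trans bc ca).
- apply/seteqP; split => T [c /= hc <-]; exists c => //=.
  + exact: homeomorphic_trans (homeomorphic_sym hab) hc.
  + exact: homeomorphic_trans hab hc.
Qed.

(* Main.v *)
Require Import Defs.
From HB Require Import structures.
From mathcomp Require Import all_boot all_order all_algebra.
From mathcomp Require Import all_classical all_reals all_analysis.
From mathcomp Require Import zify lra.

Import Order.TTheory GRing.Theory Num.Theory.

Local Open Scope classical_set_scope.
Local Open Scope ring_scope.
Local Open Scope card_scope.

(** There are at most |R| series, since a sequence of reals is determined by the
    countable set of pairs (n, q) with q rational below the n-th term, and sets of
    naturals embed into R through ternary expansions with digits 0 and 1.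

    For the lower bound, cut the naturals into blocks whose endpoints N_k grow like
    a tower of exponentials, and index the blocks by rationals so that every
    rational has infinitely many blocks.  For a real x, give the terms in the
    blocks of rationals below x the value 1 / N_k, and let the other terms form a
    convergent geometric series.  If x < y, a bijection matching the two spaces
    must send almost all of each of the infinitely many blocks between x and y
    (y-sum about 1) to x-small terms or to later blocks, where the x-terms are
    already below 2^-N_k; so a divergent set would go to a convergent one. *)

Lemma injective_card_le (T U : Type) (f : T -> U) (B : set U) :
  injective f -> (forall x, B (f x)) -> [set: T] #<= B.
Proof.
move=> finj fB; apply: (@card_le_trans _ _ _ (range f)).
  have := @inj_card_eq _ _ setT f (in2W finj).
  by rewrite card_eq_le => /andP[].
by apply: subset_card_le => _ [x _ <-].
Qed.

(** * Coding sets of naturals and real sequences by reals *)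

Definition ternary_partial (R : realType) (A : set nat) (n : nat) : R :=
  \sum_(0 <= i < n | i \in A) 3^-1 ^+ i.

Lemma ternary_partialS (R : realType) (A : set nat) n :
  ternary_partial R A n.+1 =
  ternary_partial R A n + (if n \in A then 3^-1 ^+ n else 0).
Proof. by rewrite /ternary_partial big_mkcond big_nat_recr//= -big_mkcond. Qed.

(** Partial sums increase, but decrease once the full geometric tail is added; compare both at
    [maxn m n]. *)
Lemma ternary_partial_tail (R : realType) (A : set nat) m n :
  ternary_partial R A m <= ternary_partial R A n + 3 / 2 * 3^-1 ^+ n.
Proof.
have pos k : 0 < 3^-1 ^+ k :> R by apply: exprn_gt0; lra.
have up : nondecreasing_seq (ternary_partial R A).
  apply/nondecreasing_seqP => k; rewrite ternary_partialS.
  by case: ifP => _; have := pos k; lra.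
have down : nonincreasing_seq
    (fun k => ternary_partial R A k + 3 / 2 * 3^-1 ^+ k).
  apply/nonincreasing_seqP => k; rewrite ternary_partialS exprS.
  by case: ifP => _; have := pos k; lra.
apply: le_trans (up _ _ (leq_maxl m n)) _.
apply: le_trans (down _ _ (leq_maxr m n)).
by have := pos (maxn m n); lra.
Qed.

Definition ternary (R : realType) (A : set nat) : R :=
  sup (range (ternary_partial R A)).

(** Digit [n] gains [3^-n] for [B], while all later digits of [A] gain at most half of that. *)
Lemma ternary_lt (R : realType) (A B : set nat) n :
  (forall i, (i < n)%N -> (i \in A) = (i \in B)) ->
  n \notin A -> n \in B -> ternary R A < ternary R B.
Proof.
move=> agree /negbTE nA nB.
have pos : 0 < 3^-1 ^+ n :> R by apply: exprn_gt0; lra.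
have lB : ternary_partial R B n.+1 <= ternary R B.
  apply: ub_le_sup; last by exists n.+1.
  exists (ternary_partial R B 0 + 3 / 2 * 3^-1 ^+ 0) => _ [m _ <-].
  exact: ternary_partial_tail.
have uA : ternary R A <= ternary_partial R A n.+1 + 3 / 2 * 3^-1 ^+ n.+1.
  apply: ge_sup; first by exists (ternary_partial R A 0), 0%N.
  by move=> _ [m _ <-]; exact: ternary_partial_tail.
have eqn : ternary_partial R A n = ternary_partial R B n.
  by apply: congr_big_nat => // i /andP[_ /agree ->].
move: lB uA; rewrite !ternary_partialS nA nB eqn exprS; lra.
Qed.

Lemma ternary_inj (R : realType) : injective (ternary R).
Proof.
move=> A B eqAB; apply: contrapT => neqAB.
have exn : exists n, (n \in A) != (n \in B).
  apply: contrapT => /forallNP same; apply: neqAB; apply/seteqP.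
  split=> n /mem_set => nX; apply: set_mem; have /negP/negPn/eqP := same n.
    by move=> <-.
  by move=> ->.
case: (ex_minnP exn) => n nAB minn_n.
have agree i : (i < n)%N -> (i \in A) = (i \in B).
  by move=> ltin; apply/eqP; apply: contraTT ltin => /minn_n; rewrite -leqNgt.
case nA : (n \in A) nAB; case nB : (n \in B) => // _.
  have := @ternary_lt R B A n (fun i h => esym (agree i h)).
  by rewrite nA nB eqAB ltxx => /(_ isT isT).
have := @ternary_lt R A B n agree.
by rewrite nA nB eqAB ltxx => /(_ isT isT).
Qed.

Definition rational_cuts {R : realType} (u : nat -> R) : set nat :=
  [set pickle nq | nq in [set nq : nat * rat | ratr nq.2 < u nq.1]].

Lemma rational_cuts_inj (R : realType) : injective (@rational_cuts R).
Proof.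
have lt_cut (u v : nat -> R) n :
    u n < v n -> rational_cuts u <> rational_cuts v.
  move=> /rat_in_itvoo[q]; rewrite in_itv/= => /andP[uq qv] eqc.
  have : rational_cuts v (pickle (n, q)) by exists (n, q).
  rewrite -eqc => -[nq /= lt_nq /(pcan_inj pickleK) eq_nq].
  by move: lt_nq; rewrite eq_nq/= ltNge (ltW uq).
move=> u v eqc; apply/funext => n.
by case: (ltgtP (u n) (v n)) => // /lt_cut; rewrite eqc.
Qed.

Lemma card_le_sequences (R : realType) :
  [set: nat -> {posnum R}] #<= [set: R].
Proof.
apply: (@injective_card_le _ _
  (fun a => ternary R (rational_cuts (fun n => (a n)%:num)))) => //.
move=> a b /ternary_inj/rational_cuts_inj eqab.
by apply/funext => n; apply: val_inj; exact: (congr1 (@^~ n) eqab).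
Qed.

(** * Blocks with tower endpoints *)

Definition tower (k : nat) : nat := iter k (expn 2) 4.

Lemma tower_ge4 k : (4 <= tower k)%N.
Proof.
elim: k => //= k IH; apply: leq_trans (_ : 2 ^ 2 <= _)%N => //.
by rewrite leq_exp2l//; lia.
Qed.

(** [4 * m <= 2 ^ m] holds from [m = 4] on, hence the start of [tower]. *)
Lemma tower_step k : (4 * tower k <= tower k.+1)%N.
Proof.
rewrite /= -/(tower k); have := tower_ge4 k; move: (tower k) => m.
elim: m => // m IH; rewrite leq_eqVlt => /predU1P[<-//|m4].
by have := IH m4; rewrite expnS; lia.
Qed.

Lemma tower_lt k : (tower k < tower k.+1)%N.
Proof. by have := tower_step k; have := tower_ge4 k; lia. Qed.

Lemma tower_homo : {homo tower : j k / (j <= k)%N}.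
Proof. by apply: homo_leq => [//||k]; [exact: leq_trans|exact/ltnW/tower_lt]. Qed.

Lemma ltn_tower k : (k < tower k)%N.
Proof. by elim: k => // k IH; exact: leq_ltn_trans (tower_lt k). Qed.

Fact tower_unbounded n : exists k, (n < tower k)%N.
Proof. by exists n; exact: ltn_tower. Qed.

(** Block 0 is [[0, 4[]; block [k.+1] is [[tower k, tower k.+1[], so [tower (block n)] is the right
    end of the block of [n]. *)
Definition block (n : nat) : nat := ex_minn (tower_unbounded n).

Lemma block_le n k : (block n <= k)%N = (n < tower k)%N.
Proof.
rewrite /block; case: ex_minnP => b ltnb minb; apply/idP/idP => [/tower_homo|].
  exact: leq_trans.
exact: minb.
Qed.

Lemma block_eqS n k : (block n == k.+1) = (tower k <= n < tower k.+1)%N.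
Proof. by rewrite eqn_leq block_le (ltnNge k) block_le -leqNgt andbC. Qed.

(** * Series attached to a real through rational block indices *)

Definition rat_of_index (k : nat) : rat := odflt 0 (unpickle (logn 2 k)).

(** Only the exponent of 2 codes the rational, so a power of 3 makes the index large for free. *)
Lemma rat_of_index_recurrent (q : rat) (K : nat) :
  exists2 k, (K <= k)%N & rat_of_index k.+1 = q.
Proof.
have gt0 : (0 < 2 ^ pickle q * 3 ^ K.+1)%N by rewrite muln_gt0 !expn_gt0.
exists (2 ^ pickle q * 3 ^ K.+1).-1.
  rewrite -ltnS prednK//; apply: leq_trans (leq_pmull _ _); last by rewrite expn_gt0.
  exact/ltnW/ltn_expl.
rewrite prednK// /rat_of_index lognM ?expn_gt0// pfactorK// lognX.
by rewrite (_ : logn 2 3 = 0%N)// muln0 addn0 pickleK.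
Qed.

Lemma inv_natr_gt0 (R : realType) n : (0 < n)%N -> 0 < (n%:R)^-1 :> R.
Proof. by rewrite invr_gt0 ltr0n. Qed.

Definition cut_series (R : realType) (x : R) (n : nat) : {posnum R} :=
  if ratr (rat_of_index (block n)) < x
  then PosNum (inv_natr_gt0 R _ (leq_trans (ltn0Sn 3) (tower_ge4 (block n))))
  else PosNum (inv_natr_gt0 R _ (expn_gt0 2 n.+1)).

Lemma cut_seriesE (R : realType) (x : R) n :
  (cut_series R x n)%:num =
  if ratr (rat_of_index (block n)) < x then (tower (block n))%:R^-1
  else (2 ^ n.+1)%:R^-1.
Proof. by rewrite /cut_series; case: ifP. Qed.

(** At most [M] indices can be sent injectively below [M]. *)
Lemma count_inj_ge (p : nat -> nat) (M N : nat) : injective p ->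
  (N - M <= count (fun n => M <= p n) (index_iota M N) + M)%N.
Proof.
move=> pinj; rewrite -(size_iota M (N - M)) -/(index_iota M N).
rewrite -(count_predC (fun n => M <= p n)%N) leq_add2l.
rewrite -size_filter -(size_map p) -{3}(size_iota 0 M); apply: uniq_leq_size.
  by rewrite map_inj_uniq// filter_uniq// iota_uniq.
move=> _ /mapP[n + ->]; rewrite mem_filter/= -ltnNge => /andP[lt_pM _].
by rewrite mem_iota.
Qed.

Lemma esum_geometric_le1 (R : realType) (A : set nat) :
  (\esum_(n in A) ((2 ^ n.+1)%:R^-1)%:E <= 1%:E :> \bar R)%E.
Proof.
have := @epsilon_trick0 R 1 (fun n => n \in A) ler01.
rewrite nneseries_esum; last by move=> n _; rewrite lee_fin divr_ge0.
rewrite set_mem_set; under eq_esum do rewrite mul1r.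
exact.
Qed.

(** Choosing each window beyond the previous one, [m] disjoint windows contribute at least
    [m / 2]. *)
Lemma esum_infinite (R : realType) (A : set nat) (a : nat -> R) :
  (forall n, 0 <= a n) ->
  (forall K, exists M N, [/\ (K <= M <= N)%N &
     2^-1 <= \sum_(M <= i < N | i \in A) a i]) ->
  (\esum_(n in A) (a n)%:E = +oo)%E.
Proof.
move=> a0 big; rewrite -[A in LHS]set_mem_set -nneseries_esum; last first.
  by move=> n _; rewrite lee_fin.
have step m : exists K, m%:R / 2 <= \sum_(0 <= i < K | i \in A) a i.
  elim: m => [|m [K IH]]; first by exists 0%N; rewrite mul0r big_geq.
  have [M [N [/andP[KM MN] ge]]] := big K; exists N.
  rewrite (big_cat_nat (n := M))//= (big_cat_nat (n := K) (p := M))//=.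
  have : 0 <= \sum_(K <= i < M | i \in A) a i by exact: sumr_ge0.
  by rewrite -natr1; lra.
apply/eqyP => r r0.
have [K leK] := step (Num.truncn (2 * r)).+1.
apply: (@le_trans _ _ (\sum_(0 <= i < K | i \in A) (a i)%:E)%E); last first.
  by apply: nneseries_lim_ge => i _ _; rewrite lee_fin.
rewrite sumEFin lee_fin; have := truncnS_gt (2 * r); lra.
Qed.

(* A homeomorphism carries the set [A] of those [n] with [y]-large terms that are
   [x]-small and are not moved to an earlier block: [A] diverges for [y] because
   few elements can move to earlier blocks, and its image converges for [x]. *)
Lemma cut_series_not_homeomorphic (R : realType) (x y : R) : x < y ->
  ~ homeomorphic (series_space (cut_series R y)) (series_space (cut_series R x)).
Proof.
move=> ltxy [f [g [fg gf cf cg]]].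
pose p : nat -> nat := f; have pinj : injective p by exact: can_inj fg.
pose A : set nat := [set n | (x <= ratr (rat_of_index (block n)) < y) &&
                             (block n <= block (p n))%N].
have image_finite : (\esum_(m in p @` A) ((cut_series R x m)%:num)%:E < +oo)%E.
  rewrite esum_image//; last by move=> m n _ _; exact: pinj.
  (* The second summand covers [x]-small images. An [x]-large image lies in a strictly later block,
     where the term is at most [2^-tower (block n)], and [n < tower (block n)]. *)
  apply: (@le_lt_trans _ _ (\esum_(n in A) (((2 ^ n.+1)%:R^-1)%:E +
                                       ((2 ^ (p n).+1)%:R^-1)%:E))%E).
    apply: le_esum => n /andP[/andP[xn _] le_block].
    rewrite -EFinD lee_fin cut_seriesE; case: ifP => [ltx|_]; last first.
      by rewrite lerDr.
    rewrite ler_wpDr// lef_pV2 ?posrE ?ltr0n ?expn_gt0//; last first.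
      by apply: leq_trans (tower_ge4 _).
    rewrite ler_nat; apply: (@leq_trans (tower (block n).+1)).
      by rewrite /= leq_exp2l// -block_le.
    apply: tower_homo; rewrite ltn_neqAle le_block andbT.
    by apply: contraTneq xn => ->; rewrite -ltNge.
  rewrite esumD; try by move=> n _; rewrite lee_fin.
  rewrite lte_add_pinfty//; first exact: le_lt_trans (esum_geometric_le1 _ _) (ltry _).
  rewrite -(@esum_image _ _ _ A p (fun m => ((2 ^ m.+1)%:R^-1)%:E)).
    exact: le_lt_trans (esum_geometric_le1 _ _) (ltry _).
  by move=> m n _ _; exact: pinj.
have A_infinite : (\esum_(n in A) ((cut_series R y n)%:num)%:E = +oo)%E.
  apply: esum_infinite => // K.
  have [q] := rat_in_itvoo ltxy; rewrite in_itv/= => /andP[xq qy].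
  have [k leKk kq] := rat_of_index_recurrent q K.
  exists (tower k), (tower k.+1); split.
    by rewrite (leq_trans leKk (ltnW (ltn_tower _)))//= ltnW// tower_lt.
  pose t : R := (tower k.+1)%:R.
  have t0 : 0 < t by rewrite ltr0n (leq_trans _ (tower_ge4 _)).
  (* At least [tower k.+1 - 2 * tower k] indices remain, which is at least half of [tower k.+1]. *)
  apply: (@le_trans _ _ (\sum_(tower k <= i < tower k.+1 | (tower k <= p i)%N) t^-1)).
    rewrite big_const_seq iter_addr_0 -[leRHS]mulr_natl ler_pdivlMr//.
    have := count_inj_ge p (tower k) (tower k.+1) pinj.
    move: (count _ _) => c; have := tower_step k; rewrite -/t => h1 h2.
    have : (tower k.+1 <= c * 2)%N by lia.
    by rewrite -(ler_nat R) natrM -/t; lra.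
  rewrite big_mkcond [leRHS]big_mkcond; apply: ler_sum_nat => i.
  rewrite -block_eqS => /eqP bi; case: ifP => [le_p|_]; last by case: ifP.
  rewrite ifT; last first.
    by rewrite inE /A/= bi kq (ltW xq) qy/= ltnNge block_le -leqNgt.
  by rewrite cut_seriesE bi kq qy.
have closed_A : closed (A : set (series_space (cut_series R y))).
  rewrite (_ : A = f @^-1` (p @` A)); last first.
    by apply/seteqP; split => [n An|n [m Am /pinj <-]//]; exists n.
  move/continuous_closedP: cf; apply.
  by apply/series_space_closedE; right.
move/series_space_closedE: closed_A => [AT|]; last by rewrite A_infinite.
(* [A] is not everything: it misses every block whose rational is below [x]. *)
have [q] : exists q : rat, ratr q \in `]x - 1, x[ by apply: rat_in_itvoo; lra.
rewrite in_itv/= => /andP[_ qx].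
have [k _ kq] := rat_of_index_recurrent q 0.
have : A (tower k) by rewrite AT.
move=> /andP[/andP[]]; rewrite (_ : block (tower k) = k.+1).
  by rewrite kq leNgt qx.
by apply/eqP; rewrite block_eqS leqnn tower_lt.
Qed.

Theorem mainTheorem7 (R : realType) :
  [set C | exists a : nat -> {posnum R}, C = homeo_class a] #= [set: R].
Proof.
rewrite card_eq_le; apply/andP; split.
  rewrite (_ : [set C | _] = range (@homeo_class R)).
    exact: card_le_trans (card_image_le _ _) (card_le_sequences R).
  by apply/seteqP; split => C [a] => [->|_ <-]; exists a.
apply: (@injective_card_le _ _ (fun x => homeo_class (cut_series R x))); last first.
  by move=> x; exists (cut_series R x).
move=> x y /homeo_classP hxy.
case: (ltgtP x y) => // /cut_series_not_homeomorphic.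
  by move/(_ (homeomorphic_sym hxy)).
by move/(_ hxy).
Qed.
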